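(* Let $e\in\mathbb{Z}$ with $e\notin\{-1,0,1\}$, let $n\geq 1$ be an integer and let $p\geq 2$ be a prime divisor of $n$ such that $p\mid e^{n/p}-1$ and $\gcd(\frac{n}{p},e^{n}-1)=1$. Let $\alpha=(1,2,\ldots,n)\in\mathrm{S}_n$ be a cyclic permutation of length $n$. Then for an arbitrary solution $y\in\mathrm{S}_n$, $y\neq 1$, of the equation $\alpha\circ z\circ\alpha^{-1}=z^{e}$ (in the unknown $z\in\mathrm{S}_n$), the only solutions of this equation are the powers $y,y^{2},\ldots,y^{p-1},y^{p}=1$. If $e=2$, then $n=20,21$ are examples of such integers, with $5\mid 2^{20/5}-1$, $\gcd(\frac{20}{5},2^{20}-1)=1$ and $7\mid 2^{21/7}-1$, $\gcd(\frac{21}{7},2^{21}-1)=1$. If $e=-2$, then $n=55$ is an example, with $11\mid(-2)^{55/11}-1$ and $\gcd(\frac{55}{11},(-2)^{55}-1)=1$.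
   Context: $\mathrm{S}_n$ is the symmetric group of all bijections $\{1,2,\ldots,n\}\to\{1,2,\ldots,n\}$ under composition $\circ$, and $1$ denotes its identity. *)

(* Defs.v *)
From mathcomp Require Import all_boot all_order all_fingroup all_algebra.
Set Implicit Arguments.
Unset Strict Implicit.
Unset Printing Implicit Defensive.
Import GRing.Theory.

(* The points 1, ..., n are represented by 0, ..., n-1, the elements of 'I_n. *)

(* In {perm T} the product s * t applies s first, so the composition of maps
   s \o t is the product t * s. *)
Definition perm_comp (n : nat) (s t : 'S_n) : 'S_n := (t * s)%g.

Lemma perm_compE n (s t : 'S_n) : perm_comp s t =1 s \o t.
Proof. by move=> x; rewrite permM. Qed.

(* Powers with an integer exponent; Negz m is - (m + 1). *)
Definition perm_expz (n : nat) (z : 'S_n) (e : int) : 'S_n :=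
  match e with
  | Posz m => (z ^+ m)%g
  | Negz m => (z ^- m.+1)%g
  end.

(* (1, 2, ..., n) : ordS sends i to (i + 1) mod n. *)
Definition long_cycle (n : nat) : 'S_n := perm (@ordS_inj n).

Definition is_solution (n : nat) (e : int) (z : 'S_n) : Prop :=
  perm_comp (perm_comp (long_cycle n) z) (long_cycle n)^-1%g = perm_expz z e.

Definition admissible (e : int) (n p : nat) : Prop :=
  [/\ e \notin [:: -1; 0; 1]%R,
      0 < n,
      prime p /\ p %| n,
      (p%:Z %| e ^+ (n %/ p) - 1)%Z%R
    & gcdz (n %/ p)%:Z (e ^+ n - 1)%R = 1%R].

(* Main.v *)
Require Import Defs.
From mathcomp Require Import all_boot all_order all_fingroup all_algebra.
From mathcomp Require Import cyclic.

Set Implicit Arguments.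
Unset Strict Implicit.
Unset Printing Implicit Defensive.

(** A solution satisfies [w ^ a = w ^ e], where [a] is the [n]-cycle; so [a]
    normalises [<[w]>].  The elements of [<[a]>] mapping [x] into the orbit of [x]
    under [w] form a group, which acts regularly on that orbit; so the length of
    the orbit divides [n].  It also divides [e ^ n - 1], hence it divides [p].
    Therefore every orbit of [w] lies in an orbit of [b = a ^ (n / p)], the
    order of [w] divides [p], and [w] commutes with [b] because
    [p | e ^ (n / p) - 1].  It follows that [w] is determined by its value at
    one point, and the possible values at that point are exhausted by the
    powers of any solution [y <> 1]. *)

(** * Orbits of a permutation normalised by a transitive cycle *)

Section CyclicNormaliser.

Variable T : finType.
Implicit Types (a b u v w : {perm T}) (x y : T).
Local Open Scope group_scope.

Lemma transitive_cycle_regular a x c d : porbit a x = [set: T] ->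
  c \in <[a]> -> d \in <[a]> -> c x = d x -> c = d.
Proof.
move=> tr ca da cdx; apply/permP => y.
have : y \in porbit a x by rewrite tr inE.
case/porbitP=> i ->.
have comm g : g \in <[a]> -> g ((a ^+ i) x) = (a ^+ i) (g x).
  case/cycleP=> j ->; by rewrite -!permM -!expgD addnC.
by rewrite !comm // cdx.
Qed.

Lemma transitive_cycle_order a x : porbit a x = [set: T] -> #[a] = #|T|.
Proof.
move=> tr; rewrite -cardsT -tr porbitE card_in_imset //.
by move=> c d; apply: transitive_cycle_regular.
Qed.

Lemma porbit_of_normalised a w x :
    porbit a x = [set: T] -> a \in 'N(<[w]>) ->
  #|porbit w x| %| #[a] /\
  {in porbit w x, forall y,
     exists2 b, b \in <[a]> & b ^+ #|porbit w x| = 1 /\ y = b x}.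
Proof.
move=> tr nwa; pose S := [set b in <[a]> | b x \in porbit w x].
have gS : group_set S.
  apply/group_setP; split; first by rewrite !inE group1 perm1 porbit_id.
  move=> b c; rewrite !inE => /andP[ba bx] /andP[ca cx].
  rewrite groupM //= permM.
  case/porbitP: bx => i ->; case/porbitP: cx => j cx.
  have cN : c \in 'N(<[w]>) by apply: subsetP ca; rewrite cycle_subG.
  (* Closure of [S]: [c] maps [(w ^+ i) x] to [((w ^+ i) ^ c) (c x)], and [(w ^+ i) ^ c] is again a
     power of [w]. *)
  have : (w ^+ i) ^ c \in <[w]> by rewrite memJ_norm // mem_cycle.
  case/cycleP=> k wic; rewrite -permJ wic cx -permM -expgD.
  exact: mem_porbit.
pose G := Group gS.
have imS : aperm x @: S = porbit w x.
  apply/setP=> y; apply/imsetP/idP.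
    by case=> b; rewrite inE => /andP[_ ?] ->.
  move=> yO; have : y \in porbit a x by rewrite tr inE.
  case/porbitP=> i yE; exists (a ^+ i) => //.
  by rewrite inE mem_cycle -yE.
have cS : #|porbit w x| = #|G|.
  rewrite -imS card_in_imset // => c d; rewrite !inE => /andP[ca _] /andP[da _].
  exact: (transitive_cycle_regular tr).
split.
  by rewrite cS; apply: cardSg; apply/subsetP=> b; rewrite inE => /andP[].
move=> y; rewrite -{1}imS => /imsetP[b bS ->]; exists b.
  by move: bS; rewrite inE => /andP[].
by rewrite cS expg_cardG.
Qed.

Lemma conjg_iter_exp a w f i : w ^ a = w ^+ f -> w ^ (a ^+ i) = w ^+ (f ^ i)%N.
Proof.
move=> wa; elim: i => [|i IH]; first by rewrite conjg1.
by rewrite expgSr conjgM IH conjXg wa -expgM -expnS.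
Qed.

(** * Solutions for a natural exponent [f] *)

Section Solutions.

Variables (a : {perm T}) (f m p : nat).
Hypothesis tr : forall x, porbit a x = [set: T].
Hypothesis ordT : #[a] = (m * p)%N.
Hypothesis m_gt0 : 0 < m.
Hypothesis p_pr : prime p.
Hypothesis fm1 : (f ^ m = 1 %[mod p])%N.
Hypothesis coprime_order : forall w, w ^ a = w ^+ f -> coprime m #[w].

Let b := a ^+ m.

Lemma solution_norm w : w ^ a = w ^+ f -> a \in 'N(<[w]>).
Proof.
move=> wa; rewrite inE -cycleJ cycle_subG wa; exact: mem_cycle.
Qed.

Lemma solution_card_porbit w x : w ^ a = w ^+ f -> #|porbit w x| %| p.
Proof.
move=> wa; have [dn _] := porbit_of_normalised (tr x) (solution_norm wa).
rewrite ordT mulnC in dn.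
rewrite -(Gauss_dvdl _ (_ : coprime _ m)) //.
rewrite coprime_sym; apply: coprime_dvdr (coprime_order wa).
rewrite porbitE; exact: dvdn_orbit.
Qed.

Lemma solution_expp w : w ^ a = w ^+ f -> w ^+ p = 1.
Proof.
move=> wa; apply/permP => x; rewrite perm1.
have /dvdnP[k ->] := solution_card_porbit x wa.
rewrite mulnC expgM.
elim: k => [|k IH]; first by rewrite perm1.
by rewrite expgSr permM IH permX iter_porbit.
Qed.

Lemma solution_expfm w : w ^ a = w ^+ f -> w ^+ (f ^ m)%N = w.
Proof.
move=> wa; have wp := solution_expp wa.
by rewrite -(expg_mod _ wp) fm1 (expg_mod _ wp).
Qed.

Lemma solution_commute w : w ^ a = w ^+ f -> commute w b.
Proof.
move=> wa; apply/commgP/conjg_fixP.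
by rewrite (conjg_iter_exp _ wa) solution_expfm.
Qed.

(** Each point of the orbit is [c x] with [c] in [<[a]>] and [c ^+ p = 1]; as [#[a] = m * p], such a
    [c] is a power of [b]. *)
Lemma solution_sub_porbit w x :
  w ^ a = w ^+ f -> porbit w x \subset porbit b x.
Proof.
move=> wa; apply/subsetP => y yO.
have [_ /(_ y yO)[c ca [c1 ->]]] :=
  porbit_of_normalised (tr x) (solution_norm wa).
case/cycleP: ca c1 => i -> c1.
have : a ^+ i ^+ p = 1.
  by have /dvdnP[k ->] := solution_card_porbit x wa; rewrite mulnC expgM c1 expg1n.
rewrite -expgM => /eqP; rewrite -order_dvdn ordT dvdn_pmul2r ?prime_gt0 //.
case/dvdnP=> k ->; rewrite mulnC expgM; exact: mem_porbit.
Qed.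

Lemma solution_exp w k : w ^ a = w ^+ f -> (w ^+ k) ^ a = (w ^+ k) ^+ f.
Proof. by move=> wa; rewrite conjXg wa -!expgM mulnC. Qed.

(** Commuting with [b] spreads the agreement at [x] over the whole [b]-orbit of [x], which the
    iterates of [u] never leave. *)
Lemma commuting_exp_agree u v x k :
    commute u b -> commute v b -> (forall i, (u ^+ i) x \in porbit b x) ->
  u x = v x -> (u ^+ k) x = (v ^+ k) x.
Proof.
move=> ub vb uO uvx; elim: k => [|k IH]; first by rewrite !perm1.
rewrite !expgSr !permM -IH; case/porbitP: (uO k) => j ->.
by rewrite -!permM -(commuteX j ub) -(commuteX j vb) !permM uvx.
Qed.

(* Agreement at [x] makes the [f]-th powers agree at [a x]; the exponent
   [f ^ m.-1] then undoes the [f]-th power. *)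
Lemma solution_agree_step w v x : w ^ a = w ^+ f -> v ^ a = v ^+ f ->
  w x = v x -> w (a x) = v (a x).
Proof.
move=> wa va wvx.
have E : (w ^+ f) (a x) = (v ^+ f) (a x) by rewrite -wa -va !permJ wvx.
have wfa := solution_exp f wa; have vfa := solution_exp f va.
have := commuting_exp_agree (f ^ m.-1)%N (solution_commute wfa)
  (solution_commute vfa) _ E.
rewrite -!expgM -!expnS prednK // !solution_expfm //; apply=> i.
apply: (subsetP (solution_sub_porbit (a x) wfa)); exact: mem_porbit.
Qed.

Lemma solution_agree w v x : w ^ a = w ^+ f -> v ^ a = v ^+ f ->
  w x = v x -> w = v.
Proof.
move=> wa va wvx; apply/permP=> y.
have : y \in porbit a x by rewrite tr inE.
case/porbitP=> i ->; elim: i => [|i IH]; first by rewrite perm1.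
by rewrite expgSr permM; apply: solution_agree_step.
Qed.

Lemma solution_powers (y z : {perm T}) x : y ^ a = y ^+ f -> y != 1 ->
  z ^ a = z ^+ f -> exists k, z = y ^+ k.
Proof.
move=> ya y1 za.
have cy : #|porbit y x| = p.
  have := solution_card_porbit x ya.
  case/primeP: p_pr => _ h /h/orP[/eqP c1|/eqP //].
  (* If the orbit had length 1, [y] would agree at [x] with the trivial solution 1. *)
  case/negP: y1; apply/eqP; apply: (@solution_agree _ _ x) => //.
    by rewrite conj1g expg1n.
  by have := iter_porbit y x; rewrite c1 /= perm1.
have cb : #|porbit b x| <= p.
  rewrite porbitE; apply: leq_trans (leq_imset_card _ _) _.
  apply: dvdn_leq; first exact: prime_gt0.
  by rewrite order_dvdn /b -expgM -ordT expg_order.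
have yb : porbit y x = porbit b x.
  by apply/eqP; rewrite eqEcard solution_sub_porbit // cy.
have : z x \in porbit y x.
  rewrite yb; apply: (subsetP (solution_sub_porbit x za)).
  by have := mem_porbit z 1 x; rewrite expg1.
case/porbitP=> k zk; exists k; apply: solution_agree zk => //.
exact: solution_exp.
Qed.

End Solutions.

End CyclicNormaliser.

(** * The [n]-cycle and integer exponents *)

Lemma iter_ordS n i (x : 'I_n) : iter i (@ordS n) x = (x + i) %% n :> nat.
Proof.
elim: i => [|i IH] /=; first by rewrite addn0 modn_small.
by rewrite IH -addn1 modnDml -addnA addn1.
Qed.

Lemma long_cycle_transitive n (x : 'I_n) : porbit (long_cycle n) x = [set: 'I_n].
Proof.
apply/setP=> y; rewrite inE; apply/porbitP.
(* Adding [n] keeps the exponent right when [y < x], where [y - x] would truncate. *)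
exists (y + (n - x)); rewrite permX; apply: ord_inj.
rewrite (eq_iter (f' := @ordS n)); last by move=> z; rewrite permE.
rewrite iter_ordS addnCA subnKC; last exact: ltnW.
by rewrite modnDr modn_small.
Qed.

Lemma exponent_mod_dvd (N : nat) (e : int) : 0 < N ->
  (N%:Z %| (`|(e %% N)%Z|%N)%:Z - e)%Z%R.
Proof.
move=> N0; rewrite gez0_abs; last by apply: modz_ge0; rewrite eqz_nat -lt0n.
by rewrite -eqz_mod_dvd modz_mod.
Qed.

Lemma perm_expz_nat n (z : 'S_n) (e : int) (N f : nat) :
  (z ^+ N = 1)%g -> (N%:Z %| f%:Z - e)%Z%R -> perm_expz z e = (z ^+ f)%g.
Proof.
move=> zN; case: e => k /=.
  rewrite -eqz_mod_dvd !modz_nat eqz_nat => /eqP h.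
  by rewrite -(expg_mod k zN) -h (expg_mod _ zN).
rewrite NegzE GRing.opprK => /dvdnP[c] h.
have {}h : k.+1 + f = c * N by rewrite addnC.
by apply/eqP; rewrite eq_invg_mul -expgD h mulnC expgM zN expg1n.
Qed.

Lemma is_solutionE n e (z : 'S_n) :
  is_solution e z = (z ^ long_cycle n = perm_expz z e)%g.
Proof. by rewrite /is_solution /perm_comp conjgE mulgA. Qed.

Lemma dvdz_sub_exp (d e f : int) k :
  (d %| f - e)%Z%R -> (d %| f ^+ k - e ^+ k)%Z%R.
Proof. by move=> h; rewrite GRing.subrXX dvdz_mulr. Qed.

Lemma solutions_are_powers (e : int) (n p : nat) : admissible e n p ->
  forall y : 'S_n, is_solution e y -> y <> 1%g ->
    (y ^+ p)%g = 1%g /\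
    (forall z : 'S_n,
       is_solution e z <-> exists k : nat, 1 <= k <= p /\ z = (y ^+ k)%g).
Proof.
case=> _ n0 [p_pr pn] em gcd1 y ys /eqP y1.
(* Since [n!] annihilates all of ['S_n], one residue [f] of [e] serves every [z]; [p] divides [n!],
   so [f] also inherits the congruence modulo [p]. *)
pose a := long_cycle n; pose m := n %/ p; pose N := n`!.
pose f := `|(e %% N)%Z|%N; pose x := Ordinal n0.
have N0 : 0 < N by apply: fact_gt0.
have fe := exponent_mod_dvd e N0.
have mp : m * p = n by apply: divnK.
have m0 : 0 < m by rewrite divn_gt0 ?prime_gt0 // dvdn_leq.
have zN (z : 'S_n) : (z ^+ N = 1)%g.
  have := order_dvdG (in_setT z); rewrite cardsT card_Sn order_dvdn; exact: eqP.
have solE (z : 'S_n) : is_solution e z <-> (z ^ a = z ^+ f)%g.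
  by rewrite is_solutionE (perm_expz_nat (zN z) fe).
have tr : forall x', porbit a x' = [set: 'I_n] by apply: long_cycle_transitive.
have oa : #[a]%g = n by rewrite (transitive_cycle_order (tr x)) card_ord.
have fm1 : f ^ m = 1 %[mod p].
  apply/eqP; rewrite -eqz_nat -!modz_nat eqz_mod_dvd.
  have pN : (p%:Z %| N%:Z)%Z.
    by apply: dvdn_fact; rewrite prime_gt0 // dvdn_leq.
  have h := dvdz_sub_exp m (dvdz_trans pN fe).
  have -> : ((f ^ m)%N%:Z - 1 = (f%:Z ^+ m - e ^+ m) + (e ^+ m - 1) :> int)%R.
    by rewrite GRing.addrA GRing.subrK -natz GRing.natrX natz.
  by rewrite GRing.rpredD.
have cop (w : 'S_n) : (w ^ a = w ^+ f)%g -> coprime m #[w]%g.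
  (* Conjugating [n] times by [a] gives [w = w ^+ (f ^ n)], so [#[w]] divides [f ^ n - 1] and hence
     [e ^ n - 1]. *)
  move=> wa; apply: (@coprime_dvdr _ `|(e ^+ n - 1)%R|%N); last first.
    by rewrite /coprime -eqz_nat; apply/eqP.
  rewrite -[_ %| _]/(#[w]%g%:Z %| e ^+ n - 1)%Z%R.
  have h1 : (#[w]%g%:Z %| f%:Z ^+ n - 1)%Z%R.
    have := conjg_iter_exp n wa.
    have -> : (a ^+ n = 1)%g by have := expg_order a; rewrite oa.
    rewrite conjg1 -{1}[w]expg1 => /eqP; rewrite eq_expg_mod_order.
    rewrite -eqz_nat -!modz_nat eq_sym eqz_mod_dvd.
    by rewrite -natz GRing.natrX natz.
  have wN : (#[w]%g%:Z %| N%:Z)%Z by apply/(_ : #[w]%g %| N); rewrite order_dvdn zN.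
  have h2 := dvdz_sub_exp n (dvdz_trans wN fe).
  have -> : (e ^+ n - 1 = (f%:Z ^+ n - 1) - (f%:Z ^+ n - e ^+ n) :> int)%R.
    by rewrite GRing.opprB [RHS]GRing.addrC GRing.addrA GRing.subrK.
  by rewrite GRing.rpredB.
have oa' : #[a]%g = m * p by rewrite oa mp.
have ya : (y ^ a = y ^+ f)%g by apply/solE.
have yp : (y ^+ p = 1)%g := solution_expp tr oa' cop ya.
split=> // z; split.
  move/solE => za.
  have [k ->] := solution_powers tr oa' m0 p_pr fm1 cop x ya y1 za.
  have p0 := prime_gt0 p_pr.
  (* Exponents range over 1 to [p], so residue 0 is represented by [p]. *)
  have [k0|k0] := posnP (k %% p).
    by exists p; rewrite p0 leqnn yp -(expg_mod k yp) k0.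
  by exists (k %% p); rewrite k0 (expg_mod k yp) ltnW // ltn_pmod.
by case=> k [_ ->]; apply/solE; apply: solution_exp.
Qed.

(** Serves the numerical examples: reducing [e ^+ k] to a small [r] modulo [m] avoids computing the
    large power. *)
Lemma gcdz_exp_sub1 (e : int) (m k l : nat) (r : int) :
  (e ^+ k = r %[mod m])%Z%R -> gcdz m (r ^+ l - 1) = 1%R ->
  gcdz m (e ^+ (k * l) - 1) = 1%R.
Proof.
move=> h g1; rewrite -[RHS]g1 -[LHS]gcdz_modr -[RHS]gcdz_modr; congr (gcdz _ _).
by rewrite GRing.exprM -modzDml -modzXm h modzXm modzDml.
Qed.

Theorem theorem2p11 :
  (forall (e : int) (n p : nat), admissible e n p ->
     forall y : 'S_n, is_solution e y -> y <> 1%g ->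
       (y ^+ p)%g = 1%g /\
       (forall z : 'S_n,
          is_solution e z <-> exists k : nat, 1 <= k <= p /\ z = (y ^+ k)%g)) /\
  [/\ admissible 2%:Z 20 5, admissible 2%:Z 21 7 & admissible (- 2%:Z)%R 55 11].
Proof.
split; first exact: solutions_are_powers.
split.
(* The residues used are $2^2 = 0$ mod 4, $2^3 = -1$ mod 3 and $(-2)^5 = -2$ mod 5. *)
- by split; [| | | | apply: (@gcdz_exp_sub1 _ 4 2 10 0)].
- by split; [| | | | apply: (@gcdz_exp_sub1 _ 3 3 7 (-1)%R)].
- by split; [| | | | apply: (@gcdz_exp_sub1 _ 5 5 11 (-2)%R)].
Qed.
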